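(* For $\bm{\gamma}=(\mu,\rho_\alpha,\bar\rho,\xi)^T$ let $$f_{\mathrm{WS}}(\theta|\bm{\gamma})=\frac{1-\rho_\alpha^2}{2\pi\{1+\rho_\alpha^2-2\rho_\alpha\cos(\theta-\mu)\}}\left[1+2\bar\rho\,\frac{\cos(\theta-\xi-\mu)-2\rho_\alpha\cos\xi+\rho_\alpha^2\cos(\theta+\xi-\mu)}{1+\rho_\alpha^2-2\rho_\alpha\cos(\theta-\mu)}\right]$$ (the density on the circle of the Möbius transformed cardioid distribution), and let $$\Gamma_{\mathrm{WS}}=\{(\mu,\rho_\alpha,\bar\rho,\xi)^T\mid0\le\mu<2\pi,\ 0\le\xi<2\pi,\ 0<\rho_\alpha<1,\ \bar\rho>0\}.$$ Then the family $\{f_{\mathrm{WS}}(\theta|\bm{\gamma})\mid\bm{\gamma}\in\Gamma_{\mathrm{WS}}\}$ is identifiable.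
   Context: Here $\theta$ ranges over the circle (an interval of length $2\pi$, e.g. $[0,2\pi)$). Identifiability: a family $\{f(\cdot|\bm{\gamma})\mid\bm{\gamma}\in\Gamma\}$ is identifiable if $\bm{\gamma}_1\neq\bm{\gamma}_2$ in $\Gamma$ implies that $f(\cdot|\bm{\gamma}_1)$ and $f(\cdot|\bm{\gamma}_2)$ define different distributions (different cumulative distribution functions obtained by integrating them; equivalently, the two functions are not equal almost everywhere). *)

(* Defs.v *)
From HB Require Import structures.
From mathcomp Require Import all_boot all_order all_algebra.
From mathcomp Require Import all_classical all_reals all_analysis.

Set Implicit Arguments.
Unset Strict Implicit.
Unset Printing Implicit Defensive.

Import Order.TTheory GRing.Theory Num.Theory.

Local Open Scope classical_set_scope.
Local Open Scope ring_scope.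

(* The circle is represented by [0, 2 pi], with 0 as the origin of the
   cumulative distribution function.  No positivity of [f] is required, so this
   is meaningful for any function integrable over a period. *)
Definition circular_cdf (R : realType) (f : R -> R) (t : R) : R :=
  \int[lebesgue_measure]_(theta in `[0, t]) f theta.

Definition identifiable (R : realType) (P : Type) (Gamma : set P)
    (f : P -> R -> R) : Prop :=
  forall g1 g2 : P, Gamma g1 -> Gamma g2 -> g1 <> g2 ->
    exists2 t : R, 0 <= t <= 2 * pi &
      circular_cdf (f g1) t <> circular_cdf (f g2) t.

(* A parameter is (mu, rho_alpha, rho_bar, xi). *)
Definition ws_param (R : realType) : Type := (R * R * R * R)%type.

(* The Moebius transformed cardioid density.  It is nonnegative only when
   rho_bar <= 1/2, but the formula is used for every rho_bar > 0. *)
Definition f_WS (R : realType) (g : ws_param R) (theta : R) : R :=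
  let: (mu, rho_alpha, rho_bar, xi) := g in
  (1 - rho_alpha ^+ 2) /
    (2 * pi * (1 + rho_alpha ^+ 2 - 2 * rho_alpha * cos (theta - mu))) *
  (1 + 2 * rho_bar *
     ((cos (theta - xi - mu) - 2 * rho_alpha * cos xi
        + rho_alpha ^+ 2 * cos (theta + xi - mu)) /
      (1 + rho_alpha ^+ 2 - 2 * rho_alpha * cos (theta - mu)))).

Definition Gamma_WS (R : realType) : set (ws_param R) :=
  [set g | let: (mu, rho_alpha, rho_bar, xi) := g in
    [/\ 0 <= mu < 2 * pi, 0 <= xi < 2 * pi,
        0 < rho_alpha < 1 & 0 < rho_bar]].

(* Main.v *)
Require Import Defs.
From HB Require Import structures.
From mathcomp Require Import all_boot all_order all_algebra.
From mathcomp Require Import all_classical all_reals all_analysis.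
From mathcomp Require Import complex ring lra.

(** The parameters can be read off the only pole that the density has in the
    open unit disc.  Write z = e^(i theta), w = rho_alpha e^(i mu),
    k = rho_bar e^(i (mu + xi)), and let w' and k' be the conjugates of w and
    k.  On the unit circle 1/z is the conjugate of z, so the trigonometric
    polynomials in the density become polynomials in z after multiplication by
    a power of z, and
      2 pi f = (1 - rho_alpha^2) z (a b + k' a^2 + k b^2) / (a b)^2
    where a = z - w and b = 1 - w' z ([f_WS_rational]).

    Equal distribution functions give equal densities at every interior point,
    since the densities are continuous ([circular_cdf_eq]).  Cross-multiplying
    two equal densities gives an equality of polynomials in z on an arc of the
    circle, hence everywhere ([poly_eq_on_arc]), in particular off the circle.
    At z = w the numerator takes the nonzero value
    (1 - rho_alpha^2) w k (1 - |w|^2)^2, so w is a genuine double pole; it lies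
    inside the unit disc and the other root 1/w' of the denominator lies
    outside, so both densities have the same w ([ws_pole_inj]).  The
    denominators then agree, and the value of the numerators at w yields k
    ([ws_weight_inj]).  As rho_alpha and rho_bar are positive, w and k
    determine rho_alpha, rho_bar and the angles mu and mu + xi modulo 2 pi
    ([polar_inj], [cis_inj]). *)

Set Implicit Arguments.
Unset Strict Implicit.
Unset Printing Implicit Defensive.

Import Order.TTheory GRing.Theory Num.Theory numFieldNormedType.Exports.

Local Open Scope classical_set_scope.
Local Open Scope ring_scope.
Local Open Scope complex_scope.

(** * Points of the unit circle *)

Section Cis.
Variable R : realType.
Implicit Types (x y t : R) (p q : {poly R[i]}).

Definition cis x : R[i] := cos x +i* sin x.

Lemma cisD x y : cis (x + y) = cis x * cis y.
Proof. by rewrite /cis cosD sinD; simpc; rewrite [sin x * _ + _]addrC. Qed.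

Lemma cis0 : cis 0 = 1.
Proof. by rewrite /cis cos0 sin0. Qed.

Lemma cisNM x : cis (- x) * cis x = 1.
Proof. by rewrite -cisD addNr cis0. Qed.

Lemma cis_neq0 x : cis x != 0.
Proof.
apply/eqP => cx0; have := cisNM x.
by rewrite cx0 mulr0 => /esym/eqP; rewrite oner_eq0.
Qed.

Lemma cisN x : cis (- x) = (cis x)^-1.
Proof. by apply: (mulIf (cis_neq0 x)); rewrite cisNM mulVf ?cis_neq0. Qed.

Lemma cosE_cis x : (cos x)%:C = (cis x + cis (- x)) / 2.
Proof.
have -> : cis x + cis (- x) = (cos x)%:C * 2.
  apply/eqP; rewrite /cis cosN sinN eq_complex /=.
  by apply/andP; split; apply/eqP; ring.
by rewrite mulfK // pnatr_eq0.
Qed.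

(** Two angles with the same sine and cosine have a difference whose cosine is
    1, and 1 - cos d = 2 sin^2 (d / 2) is positive for 0 < d < 2 pi. *)
Lemma cis_inj x y : `|x - y| < 2 * pi -> cis x = cis y -> x = y.
Proof.
wlog le_yx : x y / y <= x => [hw|] xy_lt cxy.
  have [/hw|/ltW/hw h] := leP y x; first exact.
  by apply/esym/h; rewrite 1?distrC.
apply/eqP; rewrite -subr_eq0; apply/negPn/negP => xy0.
have d_gt0 : 0 < x - y by rewrite lt0r xy0 subr_ge0.
have [cos_eq sin_eq] : cos x = cos y /\ sin x = sin y by case: cxy.
have cd : cos (x - y) = 1 by rewrite cosB cos_eq sin_eq -!expr2 cos2Dsin2.
have sh : 0 < sin ((x - y) / 2).
  apply: sin_gt0_pi; rewrite divr_gt0 //= ltr_pdivrMr // mulrC.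
  by rewrite -(ger0_norm (ltW d_gt0)).
have := cos_mulr2n ((x - y) / 2).
rewrite -[_ / 2 *+ 2]mulr_natr divfK ?pnatr_eq0 // cd.
rewrite cos2sin2 => h; have : 0 < sin ((x - y) / 2) ^+ 2 by rewrite exprn_gt0.
by lra.
Qed.

Lemma polar_inj (r s : R) x y : 0 < r -> 0 < s ->
  r%:C * cis x = s%:C * cis y -> r = s /\ cis x = cis y.
Proof.
move=> r0 s0 e.
have rs : r = s.
  move: (e); rewrite /cis; simpc => -[ec es].
  apply/eqP; rewrite -(eqrXn2 (ltn0Sn 1)) ?ltW //; apply/eqP.
  rewrite -[LHS]mulr1 -[RHS]mulr1 -{1}(cos2Dsin2 x) -(cos2Dsin2 y).
  by rewrite !mulrDr -!exprMn ec es.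
split=> //; move: e; rewrite rs; apply: mulfI.
by rewrite eq_complex /= eqxx andbT gt_eqF.
Qed.

(** The arc contains infinitely many points, more than a nonzero difference
    could have roots. *)
Lemma poly_eq_on_arc p q :
  (forall t, 0 < t < pi -> p.[cis t] = q.[cis t]) -> p = q.
Proof.
move=> pq; apply/eqP; rewrite -subr_eq0; apply/negPn/negP => pq0.
set n := size (p - q); have pi0 := pi_gt0 R.
pose s : seq R := [seq pi / k.+2%:R | k <- iota 0 n].
have s_itv t : t \in s -> 0 < t < pi.
  move=> /mapP[k _ ->]; rewrite divr_gt0 ?ltr0n //=.
  by rewrite ltr_pdivrMr ?ltr0n // ltr_pMr // ltr1n.
have roots : all (root (p - q)) (map cis s).
  apply/allP => _ /mapP[t /s_itv t_itv ->].
  by rewrite /root !hornerE pq // subrr.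
have uniq_roots : uniq (map cis s).
  rewrite map_inj_in_uniq; last first.
    move=> x y /s_itv /andP[x0 xpi] /s_itv /andP[y0 ypi]; apply: cis_inj.
    by rewrite ltr_norml; apply/andP; split; lra.
  rewrite map_inj_uniq ?iota_uniq // => j k /(mulfI (lt0r_neq0 pi0)) /invr_inj.
  by move=> /eqP; rewrite eqr_nat => /eqP[].
have := max_poly_roots pq0 roots uniq_roots.
by rewrite !size_map size_iota ltnn.
Qed.

End Cis.

(** * The density as a rational function of z *)

Section RationalForm.
Variable F : fieldType.
Implicit Types s w k z : F.

(** On the unit circle, with [w'] the conjugate of [w], this is z times
    |z - w|^2, the denominator of the Poisson kernel.  The conjugates [w'] and
    [k'] are independent arguments because, once the identity of polynomials
    is known, only the algebra of a field matters. *)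
Definition poisson_den w w' : {poly F} := ('X - w%:P) * (1 - w' *: 'X).

(** On the unit circle, with [w'] and [k'] the conjugates of [w] and [k] and
    with [s] equal to 1 - |w|^2, this is 2 pi f z^2 |z - w|^4, where f is the
    density. *)
Definition ws_num s w w' k k' : {poly F} :=
  s *: 'X * (poisson_den w w' + k' *: ('X - w%:P) ^+ 2
             + k *: (1 - w' *: 'X) ^+ 2).

Lemma poisson_denE w w' z :
  (poisson_den w w').[z] = (z - w) * (1 - w' * z).
Proof. by rewrite /poisson_den !hornerE. Qed.

Lemma ws_numE s w w' k k' z : (ws_num s w w' k k').[z] =
  s * z * ((z - w) * (1 - w' * z) + k' * (z - w) ^+ 2
           + k * (1 - w' * z) ^+ 2).
Proof. by rewrite /ws_num !(hornerE, poisson_denE, horner_exp). Qed.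

Lemma ws_num_pole s w w' k k' :
  (ws_num s w w' k k').[w] = s * w * (k * (1 - w' * w) ^+ 2).
Proof. by rewrite ws_numE subrr mul0r expr0n mulr0 !add0r. Qed.

(** Evaluate at [w1]: the right-hand side vanishes, and so must the second
    denominator, since the first numerator does not. *)
Lemma ws_pole_inj s1 w1 w1' k1 k1' s2 w2 w2' k2 k2' :
  s1 != 0 -> w1 != 0 -> k1 != 0 -> w1' * w1 != 1 -> w2' * w1 != 1 ->
  ws_num s1 w1 w1' k1 k1' * poisson_den w2 w2' ^+ 2 =
  ws_num s2 w2 w2' k2 k2' * poisson_den w1 w1' ^+ 2 ->
  w1 = w2.
Proof.
move=> s0 w0 k0 ww1 ww2 /(congr1 (fun p => p.[w1])).
rewrite hornerM [in RHS]hornerM !horner_exp !poisson_denE ws_num_pole.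
rewrite subrr mul0r expr0n mulr0 => /eqP eq0.
apply/eqP; apply: contraTT eq0 => w12.
have nz w' : w' * w1 != 1 -> 1 - w' * w1 != 0 by rewrite subr_eq0 eq_sym.
by rewrite !mulf_neq0 ?expf_neq0 ?mulf_neq0 ?nz // subr_eq0.
Qed.

Lemma ws_weight_inj s w w' k1 k1' k2 k2' :
  s != 0 -> w != 0 -> w' * w != 1 ->
  ws_num s w w' k1 k1' * poisson_den w w' ^+ 2 =
  ws_num s w w' k2 k2' * poisson_den w w' ^+ 2 ->
  k1 = k2.
Proof.
move=> s0 w0 ww.
have D0 : poisson_den w w' ^+ 2 != 0.
  rewrite expf_neq0 // mulf_neq0 ?polyXsubC_eq0 //.
  apply/eqP => /(congr1 (fun p => p.[w])); rewrite !hornerE => /eqP.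
  by rewrite subr_eq0 eq_sym (negPf ww).
move=> /(mulIf D0) /(congr1 (fun p => p.[w])); rewrite !ws_num_pole.
move=> /(mulfI (mulf_neq0 s0 w0)); apply: mulIf.
by rewrite expf_neq0 // subr_eq0 eq_sym.
Qed.

End RationalForm.

(** * From distribution functions to parameters *)

Section Density.
Variable R : realType.

(** The expression is at least (1 - r)^2. *)
Lemma poisson_den_gt0 (r c : R) : 0 < r < 1 -> c <= 1 ->
  0 < 1 + r ^+ 2 - 2 * r * c.
Proof.
move=> /andP[r0 r1] c1.
have : 0 < (1 - r) ^+ 2 by rewrite exprn_gt0 // subr_gt0.
have : 0 <= r * (1 - c) by rewrite mulr_ge0 ?subr_ge0 // ltW.
by rewrite sqrrB !expr2; lra.
Qed.

Lemma continuous_f_WS (g : ws_param R) : Gamma_WS g -> continuous (f_WS g).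
Proof.
case: g => [[[mu r] rho] xi] [_ _ r01 _] x.
have D0 := poisson_den_gt0 r01 (cos_le1 (x - mu)).
have cc (h : R -> R) : {for x, continuous h} -> {for x, continuous (cos \o h)}.
  by move=> ?; apply: continuous_comp => //; exact: continuous_cos.
have cD : {for x, continuous (fun t => 1 + r ^+ 2 - 2 * r * cos (t - mu))}.
  apply: cvgB; first exact: cvg_cst.
  apply: cvgM; first exact: cvg_cst.
  by apply: cc; apply: cvgB; [exact: cvg_id|exact: cvg_cst].
have pi0 := pi_gt0 R.
rewrite /f_WS; apply: cvgM.
  apply: cvgM; first exact: cvg_cst.
  apply: cvgV; first by rewrite !mulf_neq0 ?lt0r_neq0.
  by apply: cvgM => //; exact: cvg_cst.
apply: cvgD; first exact: cvg_cst.
apply: cvgM; first exact: cvg_cst.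
apply: cvgM; last by apply: cvgV => //; rewrite lt0r_neq0.
apply: cvgD; last first.
  apply: cvgM; first exact: cvg_cst.
  apply: cc; apply: cvgB; last exact: cvg_cst.
  by apply: cvgD; [exact: cvg_id|exact: cvg_cst].
apply: cvgB; last exact: cvg_cst.
apply: cc; apply: cvgB; last exact: cvg_cst.
by apply: cvgB; [exact: cvg_id|exact: cvg_cst].
Qed.

(** By the fundamental theorem of calculus a continuous function is the
    derivative of its distribution function. *)
Lemma circular_cdf_eq (f1 f2 : R -> R) : continuous f1 -> continuous f2 ->
  (forall t, 0 <= t <= 2 * pi -> circular_cdf f1 t = circular_cdf f2 t) ->
  forall t, 0 < t < 2 * pi -> f1 t = f2 t.
Proof.
move=> c1 c2 cdf_eq t /andP[t0 t2pi].
have cdf' (f : R -> R) : continuous f -> derive1 (circular_cdf f) t = f t.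
  move=> cf; rewrite /circular_cdf.
  apply: (continuous_FTC1_closed t2pi _ t0 (cf t)).2.
  apply: continuous_compact_integrable; first exact: segment_compact.
  exact: continuous_subspaceT.
rewrite -(cdf' _ c1) -(cdf' _ c2) !derive1E; apply: near_eq_derive.
near=> u; apply: cdf_eq; apply/andP; split; apply: ltW.
  by near: u; exact: lt_nbhsr.
by near: u; exact: lt_nbhsl.
Unshelve. all: by end_near. Qed.

(** The numerator cos (t - xi - mu) - 2 r cos xi + r^2 cos (t + xi - mu) is the
    real part of e^(-i xi) (z e^(-i mu) - r)^2 / (z e^(-i mu)); adding its
    conjugate produces the two squares weighted by [k'] and [k]. *)
Lemma f_WS_rational (mu r rho xi t : R) : 0 < r < 1 ->
  let w := r%:C * cis mu in let w' := r%:C * cis (- mu) in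
  let k := rho%:C * cis (mu + xi) in let k' := rho%:C * cis (- (mu + xi)) in
  (2 * pi * f_WS (mu, r, rho, xi) t)%:C * (poisson_den w w').[cis t] ^+ 2 =
  (ws_num (1 - r ^+ 2)%:C w w' k k').[cis t].
Proof.
move=> r01 w w' k k'; have D_gt0 := poisson_den_gt0 r01 (cos_le1 (t - mu)).
set D := 1 + r ^+ 2 - 2 * r * cos (t - mu) in D_gt0.
set N := cos (t - xi - mu) - 2 * r * cos xi + r ^+ 2 * cos (t + xi - mu).
have fD : 2 * pi * f_WS (mu, r, rho, xi) t * D ^+ 2
    = (1 - r ^+ 2) * (D + rho * (2 * N)).
  (* [field] would unfold pi, so it is turned into a variable *)
  rewrite /f_WS -/D -/N; move: (pi : R) (pi_gt0 R) => p p_gt0; field.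
  by rewrite !lt0r_neq0.
have DE : (poisson_den w w').[cis t] = cis t * D%:C.
  rewrite poisson_denE /D !(rmorphB, rmorphD, rmorphM, rmorphXn, rmorph1) /=.
  rewrite cosE_cis /w /w' opprB !cisD !cisN; field.
  by rewrite !cis_neq0.
have NE : (rho * (2 * N))%:C * cis t =
    k' * (cis t - w) ^+ 2 + k * (1 - w' * cis t) ^+ 2.
  rewrite /N !(rmorphB, rmorphD, rmorphM, rmorphXn, rmorph1) /=.
  rewrite !cosE_cis /w /w' /k /k' !opprD !opprK !cisD !cisN; field.
  by rewrite !cis_neq0.
rewrite ws_numE -poisson_denE -addrA -NE DE exprMn mulrCA.
rewrite -(rmorphXn (real_complex R)) -(rmorphM (real_complex R)) fD.
by rewrite rmorphM rmorphD /=; ring.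
Qed.

Lemma f_WS_inj (g1 g2 : ws_param R) : Gamma_WS g1 -> Gamma_WS g2 ->
  (forall t, 0 < t < pi -> f_WS g1 t = f_WS g2 t) -> g1 = g2.
Proof.
case: g1 => [[[mu1 r1] rho1] xi1] [/andP[mu10 mu1p] /andP[xi10 xi1p] r1_01 rho1_0].
case: g2 => [[[mu2 r2] rho2] xi2] [/andP[mu20 mu2p] /andP[xi20 xi2p] r2_01 rho2_0].
move=> feq; have [/andP[r10 r11] /andP[r20 r21]] := (r1_01, r2_01).
pose w1 := r1%:C * cis mu1; pose w1' := r1%:C * cis (- mu1).
pose w2 := r2%:C * cis mu2; pose w2' := r2%:C * cis (- mu2).
pose k1 := rho1%:C * cis (mu1 + xi1); pose k1' := rho1%:C * cis (- (mu1 + xi1)).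
pose k2 := rho2%:C * cis (mu2 + xi2); pose k2' := rho2%:C * cis (- (mu2 + xi2)).
have polys :
    ws_num (1 - r1 ^+ 2)%:C w1 w1' k1 k1' * poisson_den w2 w2' ^+ 2 =
    ws_num (1 - r2 ^+ 2)%:C w2 w2' k2 k2' * poisson_den w1 w1' ^+ 2.
  apply: poly_eq_on_arc => t /feq ft.
  by rewrite hornerM [in RHS]hornerM !horner_exp -!f_WS_rational // ft mulrAC.
have realC_neq0 (x : R) : 0 < x -> x%:C != 0.
  by move=> x0; rewrite eq_complex /= eqxx andbT gt_eqF.
have s1_neq0 : (1 - r1 ^+ 2)%:C != 0.
  by apply: realC_neq0; rewrite subr_gt0 exprn_ilt1 // ltW.
have w1_neq0 : w1 != 0 by rewrite mulf_neq0 ?cis_neq0 ?realC_neq0.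
have k1_neq0 : k1 != 0 by rewrite mulf_neq0 ?cis_neq0 ?realC_neq0.
(* w1 and the reflections in the unit circle of nonzero points of the disc lie
   on opposite sides of the circle *)
have inside_disc r mu : 0 < r < 1 -> r%:C * cis (- mu) * w1 != 1.
  move=> /andP[r_gt0 r_lt1].
  rewrite mulrACA -rmorphM -cisD; apply/eqP => /(congr1 (@complex.Re R)).
  rewrite /cis; simpc => /= e.
  have : r * r1 * cos (- mu + mu1) <= r * r1.
    by rewrite ler_piMr ?cos_le1 // mulr_ge0 // ltW.
  by rewrite e leNgt mulr_ilt1 // ltW.
have /polar_inj[//|//|r12 cis_mu] : w1 = w2.
  by apply: ws_pole_inj polys => //; exact: inside_disc.
have mu12 : mu1 = mu2.
  by apply: cis_inj cis_mu; rewrite ltr_norml; apply/andP; split; lra.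
subst r2 mu2.
have /polar_inj[//|//|rho12 cis_xi] : k1 = k2.
  exact: ws_weight_inj s1_neq0 w1_neq0 (inside_disc r1 mu1 r1_01) polys.
have xi12 : mu1 + xi1 = mu1 + xi2.
  by apply: cis_inj cis_xi; rewrite ltr_norml; apply/andP; split; lra.
by rewrite rho12 (addrI _ xi12).
Qed.

End Density.

Theorem proposition5 (R : realType) :
  identifiable (@Gamma_WS R) (@f_WS R).
Proof.
move=> g1 g2 G1 G2 g12; apply: contrapT => no_t; apply: g12.
apply: f_WS_inj => // t /andP[t0 tpi].
apply: (circular_cdf_eq (continuous_f_WS G1) (continuous_f_WS G2)); last first.
  by rewrite t0 /=; lra.
by move=> u u_itv; apply: contrapT => ne; apply: no_t; exists u.
Qed.
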